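(* In the setting of the context, for every $\mu\in\mathbb{G}$, $$\mathsf{U}(\mathcal{I}_\xi\mathcal{P}^*_\mu)=\xi^{-1/2}(\mathfrak{p}-|\mu|)(\mathcal{I}_\xi\mathcal{P}^*_\mu),$$ $$\mathsf{D}(\mathcal{I}_\xi\mathcal{P}^*_\mu)=\xi^{1/2}(\mathfrak{p}+|\mu|+\mathsf{t})(\mathcal{I}_\xi\mathcal{P}^*_\mu)+\xi^{1/2}\sum_{\rho\nearrow\mu}\kappa(\rho,\mu)\mathsf{q}(\mu/\rho)^2(\mathcal{I}_\xi\mathcal{P}^*_\rho),$$ where $\mathfrak{p}$ denotes multiplication by the function $\lambda\mapsto|\lambda|$.
   Context: $P$ is a poset in which every element lies in some finite order ideal; $\mathbb{G}=J(P)$ is the set of finite order ideals, $|\lambda|$ its cardinality, $\mathbb{G}_n=\{|\lambda|=n\}$ assumed finite, and every ideal is contained in one with one more element. $\mu\nearrow\lambda$ (or $\lambda\searrow\mu$) means $\mu\subset\lambda$, $|\lambda|=|\mu|+1$; $\lambda/\mu$ is the element of $\lambda\setminus\mu$. $\kappa(\mu,\lambda)>0$ is given for each $\mu\nearrow\lambda$ and is UD-self-dual: $\kappa(\mu,\lambda)\kappa(\mu,\rho)=\kappa(\lambda,\nu)\kappa(\rho,\nu)$ whenever $\mu\nearrow\lambda\nearrow\nu$, $\mu\nearrow\rho\nearrow\nu$, $\rho\ne\lambda$. $\dim(\mu,\lambda)$ is the sum over chains $\mu=\lambda^{(0)}\nearrow\cdots\nearrow\lambda^{(k)}=\lambda$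 of $\prod\kappa(\lambda^{(i)},\lambda^{(i+1)})$ ($=1$ if $\mu=\lambda$, $0$ if $\mu\not\subseteq\lambda$), $\dim\lambda=\dim(\varnothing,\lambda)$. A function $\mathsf{q}:P\to(0,\infty)$ is given with $\sum_{\nu\searrow\lambda}\kappa(\lambda,\nu)^2\mathsf{q}(\nu/\lambda)^2-\sum_{\mu\nearrow\lambda}\kappa(\mu,\lambda)^2\mathsf{q}(\lambda/\mu)^2=2|\lambda|+\mathsf{t}$ for all $\lambda$, where $\mathsf{t}=\sum_{\nu\searrow\varnothing}\kappa(\varnothing,\nu)^2\mathsf{q}(\nu/\varnothing)^2>0$. The Kerov's operators act on arbitrary functions $f$ on $\mathbb{G}$ pointwise by $(\mathsf{U}f)(\lambda)=\sum_{\varkappa\nearrow\lambda}\kappa(\varkappa,\lambda)\mathsf{q}(\lambda/\varkappa)f(\varkappa)$ and $(\mathsf{D}f)(\lambda)=\sum_{\nu\searrow\lambda}\kappa(\lambda,\nu)\mathsf{q}(\nu/\lambda)f(\nu)$ (on finitely supported functions these are $\mathsf{U}e_\lambda=\sum_{\nu\searrow\lambda}\kappa(\lambda,\nu)\mathsf{q}(\nu/\lambda)e_\nu$, $\mathsf{D}e_\lambda=\sum_{\mu\nearrow\lambda}\kappa(\mu,\lambda)\mathsf{q}(\lambda/\mu)e_\mu$). For $\xi\in(0,1)$, $M_\xi(\lambda)=(1-\xi)^{\mathsf{t}}\xi^{|\lambda|}\big(\frac{\dim\lambda}{|\lambda|!}\big)^2\prod_{\square\in\lambda}\mathsf{q}(\square)^2$,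 and $(\mathcal{I}_\xi f)(\lambda)=f(\lambda)M_\xi(\lambda)^{1/2}$ (positive square root). The relative dimension functions are $\mathcal{P}^*_\mu(\lambda)=|\lambda|^{\downarrow|\mu|}\frac{\dim(\mu,\lambda)}{\dim\lambda}$, $a^{\downarrow k}=a(a-1)\cdots(a-k+1)$. *)

(* Defs.v *)
From HB Require Import structures.
From mathcomp Require Import all_boot all_order all_algebra finmap.
From mathcomp Require Import all_classical all_reals all_analysis.

Set Implicit Arguments.
Unset Strict Implicit.
Unset Printing Implicit Defensive.

Import Order.TTheory GRing.Theory Num.Theory.

Local Open Scope classical_set_scope.
Local Open Scope ring_scope.

Section Ideals.
Context {d : Order.disp_t} (P : porderType d).

Definition order_ideal (I : {fset P}) : Prop :=
  forall x y : P, x \in I -> (y <= x)%O -> y \in I.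

Record ideal := Ideal {
  ideal_fset :> {fset P};
  _ : `[< order_ideal ideal_fset >] }.

HB.instance Definition _ := [isSub for ideal_fset].
HB.instance Definition _ := [Choice of ideal by <:].

Lemma order_ideal0 : order_ideal fset0.
Proof. by move=> x y; rewrite inE. Qed.

Definition ideal0 : ideal := Ideal (asboolT order_ideal0).

End Ideals.

Section BranchingGraph.
Context {d : Order.disp_t} {P : porderType d}.
Implicit Types mu la nu rho : ideal P.

Definition covers mu la : bool :=
  (mu `<=` la)%fset && (#|` la | == #|` mu |.+1).

Definition skew_elt mu la : option P := ohead (enum_fset (la `\` mu)%fset).

(* On a covering pair the difference is a singleton, so [None] is a junk value. *)
Lemma skew_eltP mu la : covers mu la ->
  exists2 x, (la `\` mu)%fset = [fset x]%fset & skew_elt mu la = Some x.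
Proof.
move=> /andP[sub /eqP sz].
have /eqP/cardfs1P[x Dx] : #|` (la `\` mu)%fset | = 1%N.
  by rewrite cardfsD (fsetIidPr sub) sz subSnn.
exists x => //; rewrite /skew_elt Dx.
have : x \in enum_fset [fset x]%fset by exact: fset11.
have : forall y, y \in enum_fset [fset x]%fset -> y = x by move=> y /fset1P.
by case: (enum_fset _) => [|y s] //= /(_ y); rewrite mem_head => ->.
Qed.

End BranchingGraph.

Section Kerov.
Context {d : Order.disp_t} {P : porderType d} {R : realType}.
Variables (kappa : ideal P -> ideal P -> R) (q : P -> R).
Implicit Types mu la nu rho : ideal P.

Definition UD_self_dual : Prop :=
  forall mu la rho nu, covers mu la -> covers la nu ->
    covers mu rho -> covers rho nu -> rho <> la ->
  kappa mu la * kappa mu rho = kappa la nu * kappa rho nu.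

Definition chain_weight mu (s : seq (ideal P)) : R :=
  \prod_(e <- zip (mu :: s) s) kappa e.1 e.2.

(* The chain mu = la_0, la_1, ..., la_k = la is encoded by its tail
   [:: la_1; ...; la_k], as in [path]. *)
Definition rdim mu la : R :=
  \sum_(s \in [set s : seq (ideal P) | path covers mu s /\ last mu s = la])
    chain_weight mu s.

Definition gdim la : R := rdim (ideal0 P) la.

Definition q_skew mu la : R := oapp q 0 (skew_elt mu la).

Definition tpar : R :=
  \sum_(nu \in [set nu | covers (ideal0 P) nu])
    kappa (ideal0 P) nu ^+ 2 * q_skew (ideal0 P) nu ^+ 2.

Definition kerov_commutation : Prop :=
  forall la,
    \sum_(nu \in [set nu | covers la nu])
      kappa la nu ^+ 2 * q_skew la nu ^+ 2
    - \sum_(mu \in [set mu | covers mu la])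
        kappa mu la ^+ 2 * q_skew mu la ^+ 2
    = 2 * #|` la |%:R + tpar.

Definition kerovU (f : ideal P -> R) la : R :=
  \sum_(mu \in [set mu | covers mu la]) kappa mu la * q_skew mu la * f mu.

Definition kerovD (f : ideal P -> R) la : R :=
  \sum_(nu \in [set nu | covers la nu]) kappa la nu * q_skew la nu * f nu.

Definition Mxi (xi : R) la : R :=
  (1 - xi) `^ tpar * xi ^+ #|` la | * (gdim la / (#|` la |)`!%:R) ^+ 2
  * \prod_(b <- enum_fset la) q b ^+ 2.

Definition Ixi (xi : R) (f : ideal P -> R) la : R := f la * Num.sqrt (Mxi xi la).

Definition rel_dim mu la : R :=
  (#|` la | ^_ #|` mu |)%:R * (rdim mu la / gdim la).

End Kerov.

(* Main.v *)
(** Up to a constant, [Ixi (rel_dim mu)] at [la] is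
    [xi^(n/2) * (\prod_(b in la) q b) / (n - m)! * dim(mu, la)] with
    [n = |la|], [m = |mu|]: the factor [dim la] cancels.  The formula for U is
    then the branching recursion of [dim(mu, -)].  The formula for D becomes
    [\sum_(nu covering la) kappa(la, nu) q(nu/la)^2 dim(mu, nu)
      = (n + 1 - m)(n + m + t) dim(mu, la)
        + \sum_(rho covered by mu) kappa(rho, mu) q(mu/rho)^2 dim(rho, la)],
    proved by induction on [n]: expand [dim(mu, nu)] by the recursion and
    exchange "up after down" with "down after up"; the off-diagonal terms
    match through the diamond [(la `&` rho, la, rho, la `|` rho)] and
    UD-self-duality, the diagonal ones give [2n + t]. *)

Require Import Defs.
From mathcomp Require Import all_boot all_order all_algebra finmap.
From mathcomp Require Import all_classical all_reals all_analysis.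
From mathcomp Require Import ring zify.

Set Implicit Arguments.
Unset Strict Implicit.
Unset Printing Implicit Defensive.

Import Order.TTheory GRing.Theory Num.Theory.

Local Open Scope classical_set_scope.
Local Open Scope ring_scope.

(** * Joins, meets and covering pairs of finite order ideals *)

Section IdealLattice.
Context {d : Order.disp_t} {P : porderType d}.
Implicit Types mu la nu rho : ideal P.

Lemma ideal_closed la (x y : P) :
  x \in (la : {fset P}) -> (y <= x)%O -> y \in (la : {fset P}).
Proof. by case: la => s /= /asboolP H; exact: H. Qed.

Lemma order_idealU la rho : order_ideal (la `|` rho)%fset.
Proof.
move=> x y; rewrite !inE => /orP[] xI le_yx; apply/orP; [left|right];
  exact: ideal_closed xI le_yx.
Qed.

Lemma order_idealI la rho : order_ideal (la `&` rho)%fset.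
Proof.
move=> x y; rewrite !inE => /andP[xl xr] le_yx.
by rewrite (ideal_closed xl le_yx) (ideal_closed xr le_yx).
Qed.

Definition idealU la rho : ideal P :=
  Ideal (asboolT (@order_idealU la rho)).
Definition idealI la rho : ideal P :=
  Ideal (asboolT (@order_idealI la rho)).

Lemma coversS mu la : covers mu la -> #|` la | = #|` mu |.+1.
Proof. by move=> /andP[_ /eqP]. Qed.

Lemma exists_maximal (s : seq P) : s != [::] ->
  exists2 x, x \in s & forall y, y \in s -> (x <= y)%O -> y = x.
Proof.
elim: s => // x [|z s] IH _.
  by exists x; rewrite ?mem_head // => y; rewrite inE => /eqP.
have [//|m m_in m_max] := IH.
case: (boolP (m <= x)%O) => le_mx.
  exists x; first exact: mem_head.
  move=> y; rewrite in_cons => /orP[/eqP //|ys] le_xy.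
  have Dy := m_max y ys (le_trans le_mx le_xy); apply/le_anti.
  by rewrite le_xy Dy le_mx.
exists m; first by rewrite in_cons m_in orbT.
move=> y; rewrite in_cons => /orP[/eqP -> le_mx'|]; last exact: m_max.
by rewrite le_mx' in le_mx.
Qed.

(** Removing a maximal element of [la] leaves an order ideal. *)
Lemma exists_covered la n : #|` la | = n.+1 -> exists mu, covers mu la.
Proof.
move=> sz_la.
have [|x x_la x_max] := @exists_maximal (enum_fset la).
  by rewrite -size_eq0; move: sz_la => /= ->.
have idl : order_ideal (la `\ x)%fset.
  move=> y z; rewrite !inE => /andP[y_x y_la] le_zy.
  rewrite (ideal_closed y_la le_zy) andbT; apply: contraNneq y_x => zx.
  by apply/eqP/x_max => //; rewrite -zx.
exists (Ideal (asboolT idl)); rewrite /covers /= fsubD1set /=.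
by rewrite [#|` la |](cardfsD1 x) x_la.
Qed.

(** The union lies in [nu]; were it no larger than [la], it would equal [la] and contain [rho], and
    equal sizes would force [la = rho]. *)
Lemma covers_join la rho nu : la != rho -> covers la nu -> covers rho nu ->
  nu = idealU la rho.
Proof.
move=> neq /andP[sl /eqP cl] /andP[sr /eqP cr]; apply/val_inj/esym/eqP => /=.
have sz : #|` rho | = #|` la | by apply: succn_inj; rewrite -cl -cr.
rewrite eqEfcard fsubUset sl sr /= cl ltnNge; apply: contra neq => le_U.
have El : la = (la `|` rho)%fset :> {fset P}.
  by apply/eqP; rewrite eqEfcard fsubsetUl.
apply/eqP/val_inj/esym/eqP => /=.
by rewrite eqEfcard sz leqnn andbT El fsubsetUr.
Qed.

Lemma covers_meet la rho mu : la != rho -> covers mu la -> covers mu rho ->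
  mu = idealI la rho.
Proof.
move=> neq /andP[sl /eqP cl] /andP[sr /eqP cr]; apply/val_inj/eqP => /=.
rewrite eqEfcard fsubsetI sl sr /= -ltnS -cl ltnNge; apply: contra neq => le_I.
have El : (la `&` rho)%fset = la :> {fset P}.
  by apply/eqP; rewrite eqEfcard fsubsetIl.
apply/eqP/val_inj/eqP => /=.
by rewrite eqEfcard cl cr leqnn andbT -El fsubsetIr.
Qed.

(** The sizes of join and meet add up to twice the size of [rho], so the join is one larger exactly
    when the meet is one smaller. *)
Lemma covers_diamond la rho : #|` la | = #|` rho | ->
  covers la (idealU la rho) && covers rho (idealU la rho)
  = covers (idealI la rho) la && covers (idealI la rho) rho.
Proof.
move=> sz; rewrite /covers /= fsubsetUl fsubsetUr fsubsetIl fsubsetIr /=.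
have := cardfsUI la rho; rewrite sz.
set a := #|` (la `|` _)%fset|; set b := #|` (la `&` _)%fset|.
set c := #|` rho |; lia.
Qed.

(** Both differences consist of the elements of [rho] outside [la]; this matches the [q] factors on
    opposite edges of a diamond. *)
Lemma skew_elt_diamond la rho :
  skew_elt la (idealU la rho) = skew_elt (idealI la rho) rho.
Proof.
rewrite /skew_elt /=; congr (ohead (enum_fset _)).
by apply/fsetP => x; rewrite !inE; case: (x \in _); case: (x \in _).
Qed.

End IdealLattice.

(** * Finite levels, lists of chains and the branching recursion for dim(mu, -) *)

Section Levels.
Context {d : Order.disp_t} {P : porderType d}.
Implicit Types mu la nu rho : ideal P.
Hypothesis levels_finite :
  forall n : nat, finite_set [set la : ideal P | #|` la | = n].

Definition level n : seq (ideal P) :=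
  enum_fset (fset_set [set la : ideal P | #|` la | = n]).

Lemma level_uniq n : uniq (level n).
Proof. exact: fset_uniq. Qed.

Lemma mem_level n la : (la \in level n) = (#|` la | == n).
Proof.
rewrite /level [LHS](in_fset_set (levels_finite n)).
by apply/idP/eqP; rewrite inE.
Qed.

Lemma fsbig_level {R : realType} n (p : pred (ideal P)) (F : ideal P -> R) :
  (forall nu, p nu -> #|` nu | = n) ->
  \sum_(nu \in [set nu | p nu]) F nu = \sum_(nu <- level n | p nu) F nu.
Proof.
move=> sz; rewrite -[RHS]big_filter [RHS]fsbig_seq ?filter_uniq ?level_uniq //.
apply: eq_fsbigl; apply/seteqP; split=> nu /=; rewrite mem_filter mem_level.
  by move=> pnu; rewrite pnu; apply/eqP/sz.
by case/andP.
Qed.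

Lemma fsbig_covering {R : realType} la (F : ideal P -> R) :
  \sum_(nu \in [set nu | covers la nu]) F nu
  = \sum_(nu <- level #|` la |.+1 | covers la nu) F nu.
Proof. by apply: fsbig_level => nu /coversS. Qed.

(** For empty [la] the truncated predecessor selects level 0, harmlessly: nothing is covered by
    [la]. *)
Lemma fsbig_covered {R : realType} la (F : ideal P -> R) :
  \sum_(mu \in [set mu | covers mu la]) F mu
  = \sum_(mu <- level #|` la |.-1 | covers mu la) F mu.
Proof. by apply: fsbig_level => mu /coversS ->. Qed.

(* As in [chain_weight], a chain is encoded without its first element [mu]. *)
Fixpoint chains k mu la : seq (seq (ideal P)) :=
  if k is k'.+1 then
    [seq rcons s la | tau <- [seq tau <- level #|` la |.-1 | covers tau la],
                      s <- chains k' mu tau]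
  else if mu == la then [:: [::]] else [::].

Lemma path_size mu s : path covers mu s -> #|` last mu s | = (#|` mu | + size s)%N.
Proof.
elim: s mu => [|nu s IH] mu /=; first by rewrite addn0.
by move=> /andP[/coversS sz /IH ->]; rewrite sz addSnnS.
Qed.

Lemma mem_chains k mu la s :
  (s \in chains k mu la)
  = [&& path covers mu s, last mu s == la & size s == k].
Proof.
elim: k la s => [|k IH] la s.
  rewrite /=; case: eqVneq => [->|neq]; rewrite ?inE.
    by case: s => [|? ?] /=; rewrite ?eqxx // andbF andbF.
  by case: s => [|? ?] /=; rewrite ?(negPf neq) // andbF andbF.
apply/allpairsPdep/idP => [[tau [s' [tau_in s'_in ->]]]|].
  move: tau_in s'_in; rewrite mem_filter IH => /andP[cov _] /and3P[pth /eqP lst /eqP sz].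
  by rewrite rcons_path last_rcons size_rcons pth lst cov sz !eqxx.
case/lastP: s => [|s x]; first by rewrite /= andbF.
rewrite rcons_path last_rcons size_rcons eqSS => /and3P[/andP[pth cov] /eqP Dx sz].
subst x; exists (last mu s), s; split=> //; last by rewrite IH pth eqxx sz.
by rewrite mem_filter cov mem_level (coversS cov) /=.
Qed.

Lemma chains_uniq k mu la : uniq (chains k mu la).
Proof.
elim: k la => [|k IH] la /=; first by case: ifP.
apply: allpairs_uniq_dep => //; first by rewrite filter_uniq ?level_uniq.
move=> _ _ /allpairsPdep[t1 [s1 [_ in1 ->]]] /allpairsPdep[t2 [s2 [_ in2 ->]]] /=.
move=> /rcons_inj[Es]; subst s2.
move: in1 in2; rewrite !mem_chains => /and3P[_ /eqP <- _] /and3P[_ /eqP <- _].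
by [].
Qed.

Context {R : realType} (kappa : ideal P -> ideal P -> R).

Lemma chain_weight_rcons mu s la :
  chain_weight kappa mu (rcons s la)
  = chain_weight kappa mu s * kappa (last mu s) la.
Proof.
rewrite /chain_weight; elim: s mu => [|nu s IH] mu /=.
  by rewrite big_cons !big_nil mulr1 mul1r.
by rewrite !big_cons IH mulrA.
Qed.

(** Each covering step adds one element, so the sizes of the endpoints fix the length [k]; the
    chains then form a duplicate-free list and the sum in [rdim] is genuinely finite. *)
Lemma rdim_chains k mu la : #|` la | = (#|` mu | + k)%N ->
  rdim kappa mu la = \sum_(s <- chains k mu la) chain_weight kappa mu s.
Proof.
move=> sz; rewrite [RHS]fsbig_seq ?chains_uniq //; apply: eq_fsbigl.
apply/seteqP; split=> s /=; rewrite mem_chains.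
  move=> [pth lst]; rewrite pth lst eqxx /=.
  by have := path_size pth; rewrite lst sz => /addnI ->.
by move=> /and3P[-> /eqP ->].
Qed.

Lemma rdimxx mu : rdim kappa mu mu = 1.
Proof.
rewrite (@rdim_chains 0) ?addn0 //= eqxx big_seq1.
by rewrite /chain_weight big_nil.
Qed.

Lemma rdim_small mu la : (#|` la | <= #|` mu |)%N ->
  rdim kappa mu la = (mu == la)%:R.
Proof.
move=> le_sz; case: eqVneq => [->|neq]; first exact: rdimxx.
apply: fsbig1 => s [pth lst]; case: s pth lst => [_ /= E|nu s pth lst].
  by rewrite E eqxx in neq.
have := path_size pth; rewrite lst /= => E; move: le_sz.
by rewrite E addnS -ltn_subRL subnn.
Qed.

(** Chains are split at their last step; the bound on |mu| excludes the empty chain, which has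
    none. *)
Lemma rdim_rec n mu la : #|` la | = n.+1 -> (#|` mu | <= n)%N ->
  rdim kappa mu la
  = \sum_(tau <- level n | covers tau la) kappa tau la * rdim kappa mu tau.
Proof.
move=> sz le_n; rewrite (@rdim_chains (n - #|` mu |).+1); last first.
  by rewrite sz addnS subnKC.
rewrite /= sz /= big_allpairs_dep big_filter.
rewrite big_seq_cond [RHS]big_seq_cond.
apply: eq_bigr => tau /andP[tau_in cov].
rewrite (@rdim_chains (n - #|` mu |)); last first.
  by move: tau_in; rewrite mem_level subnKC // => /eqP.
rewrite mulr_sumr big_seq [RHS]big_seq; apply: eq_bigr => s.
rewrite mem_chains => /and3P[_ /eqP lst _].
by rewrite chain_weight_rcons lst mulrC.
Qed.

Hypothesis kappa_gt0 : forall mu la, covers mu la -> 0 < kappa mu la.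

(** Needed to cancel dim la in [Ixi (rel_dim mu) la]. All terms of the recursion are positive, and
    [exists_covered] provides at least one. *)
Lemma gdim_gt0 la : 0 < gdim kappa la.
Proof.
move Dn: #|` la | => n; elim: n la Dn => [|n IH] la sz.
  rewrite /gdim rdim_small ?sz //.
  suff -> : ideal0 P = la by rewrite eqxx ltr01.
  by apply/val_inj/esym/eqP; rewrite -cardfs_eq0 /= sz.
rewrite /gdim (rdim_rec sz) ?cardfs0 //.
have pos (tau : ideal P) : #|` tau | = n -> covers tau la ->
    0 < kappa tau la * rdim kappa (ideal0 P) tau.
  by move=> /IH gt0 /kappa_gt0 k_gt0; rewrite mulr_gt0.
have [tau cov] := exists_covered sz.
have sz_tau : #|` tau | = n by apply: succn_inj; rewrite -(coversS cov).
rewrite -big_filter (big_rem tau) /=; last by rewrite mem_filter cov mem_level sz_tau /=.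
rewrite ltr_pwDl ?pos // big_seq sumr_ge0 // => rho /mem_rem.
by rewrite mem_filter mem_level => /andP[cr /eqP szr]; rewrite ltW ?pos.
Qed.

End Levels.

(** * Commutation of the weighted up and down operators, and their action on dim(mu, -) *)

Lemma big_only_one (R : nmodType) (T : eqType) (r : seq T) (p : pred T)
    (F : T -> R) (u : T) :
  uniq r -> (forall v, p v -> v = u) -> (p u -> u \in r) ->
  \sum_(v <- r | p v) F v = if p u then F u else 0.
Proof.
move=> r_uniq only mem; case: ifP => pu; last first.
  by rewrite big1 // => v pv; move: pu; rewrite -(only v pv) pv.
rewrite (eq_bigl (pred1 u)) => [|v]; last by apply/idP/eqP => [/only|->].
by rewrite -big_filter filter_pred1_uniq ?big_seq1 // mem.
Qed.

Section WeightedKerov.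
Context {d : Order.disp_t} {P : porderType d} {R : realType}.
Context (kappa : ideal P -> ideal P -> R) (q : P -> R).
Implicit Types (mu la nu rho tau : ideal P) (f : ideal P -> R).
Hypothesis levels_finite :
  forall n : nat, finite_set [set la : ideal P | #|` la | = n].

(* [wup] and [wdown] are the Kerov operators D and U conjugated by
   multiplication with the product of [q] over the ideal. *)
Definition wup f la : R :=
  \sum_(nu \in [set nu | covers la nu])
    kappa la nu * q_skew q la nu ^+ 2 * f nu.

Definition wdown f la : R :=
  \sum_(tau \in [set tau | covers tau la]) kappa tau la * f tau.

Lemma rdim_wdown mu la : (#|` mu | < #|` la |)%N ->
  rdim kappa mu la = wdown (rdim kappa mu) la.
Proof.
case Dn: #|` la | => [//|n] lt_mu.
by rewrite (rdim_rec levels_finite kappa Dn) // /wdown fsbig_covered // Dn.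
Qed.

Lemma wup_ext f g la : (forall nu, covers la nu -> f nu = g nu) ->
  wup f la = wup g la.
Proof. by move=> fg; apply: eq_fsbigr => nu /set_mem cov; rewrite fg. Qed.

Lemma rdim_wdown_covering mu la : (#|` mu | <= #|` la |)%N ->
  forall nu, covers la nu -> rdim kappa mu nu = wdown (rdim kappa mu) nu.
Proof. by move=> le_mu nu /coversS sz; rewrite -rdim_wdown // sz. Qed.

(** In these sizes every relative dimension is an indicator, so both sides reduce to the possible
    edge from [la] to [mu]: the term [nu = mu] on the left, [rho = la] on the right. *)
Lemma wup_rdim_small mu la : (#|` la | < #|` mu |)%N ->
  wup (rdim kappa mu) la
  = (#|` la |.+1%:R - #|` mu |%:R) * (#|` la |%:R + #|` mu |%:R + tpar kappa q)
      * rdim kappa mu la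
    + \sum_(rho <- level #|` mu |.-1 | covers rho mu)
        kappa rho mu * q_skew q rho mu ^+ 2 * rdim kappa rho la.
Proof.
move=> lt_la; rewrite [rdim _ mu la]rdim_small 1?ltnW //.
have /negPf -> : mu != la by apply: contraTneq lt_la => ->; rewrite ltnn.
rewrite mulr0 add0r /wup fsbig_covering //.
have only (T : eqType) (r : seq T) (p : pred T) (F : T -> R) (u : T) :
    uniq r -> (p u -> u \in r) ->
    \sum_(v <- r | p v) F v * (v == u)%:R = if p u then F u else 0.
  move=> r_uniq mem; rewrite (bigID (pred1 u)) /= [X in _ + X]big1 ?addr0.
    rewrite (@big_only_one _ _ _ _ _ u) ?eqxx ?andbT ?mulr1 //.
    by move=> v /andP[_ /eqP].
  by move=> v /andP[_ /negPf ->]; rewrite mulr0.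
transitivity (if covers la mu then kappa la mu * q_skew q la mu ^+ 2 else 0).
  rewrite -(only _ (level #|` la |.+1) (covers la)
    (fun nu => kappa la nu * q_skew q la nu ^+ 2)) ?level_uniq //; last first.
    by move=> /coversS sz; rewrite mem_level // sz.
  apply: eq_bigr => nu /coversS sz.
  by rewrite [rdim _ _ _]rdim_small ?sz // eq_sym.
rewrite -(only _ (level #|` mu |.-1) (covers^~ mu)
  (fun rho => kappa rho mu * q_skew q rho mu ^+ 2)) ?level_uniq //; last first.
  by move=> /coversS sz; rewrite mem_level // sz.
apply: eq_bigr => rho /coversS sz.
by rewrite [rdim _ _ _]rdim_small // -ltnS -sz.
Qed.

Hypothesis kappa_self_dual : UD_self_dual kappa.

(** Each side has at most one term, at the join and at the meet respectively, and these exist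
    together; UD-self-duality and [skew_elt_diamond] equate them. *)
Lemma sum_diamond n la rho : #|` la | = n -> #|` rho | = n -> la != rho ->
  \sum_(nu <- level n.+1 | covers la nu && covers rho nu)
     kappa la nu * kappa rho nu * q_skew q la nu ^+ 2
  = \sum_(tau <- level n.-1 | covers tau la && covers tau rho)
     kappa tau la * kappa tau rho * q_skew q tau rho ^+ 2.
Proof.
move=> sz_la sz_rho neq.
rewrite (@big_only_one _ _ _ _ _ (idealU la rho)) ?level_uniq //; first last.
- by move=> /andP[/coversS sz _]; rewrite mem_level // sz sz_la.
- by move=> nu /andP[c1 c2]; exact: covers_join c1 c2.
rewrite (@big_only_one _ _ _ _ _ (idealI la rho)) ?level_uniq //; first last.
- by move=> /andP[/coversS sz _]; rewrite mem_level // -sz_la sz.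
- by move=> tau /andP[c1 c2]; exact: covers_meet c1 c2.
have E := covers_diamond (etrans sz_la (esym sz_rho)).
rewrite -E; case: ifP => // c_join.
have [cl cr] := andP c_join; move: c_join; rewrite E => /andP[il ir].
rewrite -(kappa_self_dual il cl ir cr); last by move=> Er; rewrite Er eqxx in neq.
by rewrite /q_skew skew_elt_diamond.
Qed.

Hypothesis kappa_q_kerov : kerov_commutation kappa q.

(** The commutator of [wup] and [wdown] is 2|la| + t. Both compositions sum over two-step paths from
    [la] to some [rho] of the same size; [kerov_commutation] settles [rho = la], and [sum_diamond]
    the rest. *)
Lemma wup_wdown f la :
  wup (wdown f) la
  = (2 * #|` la |%:R + tpar kappa q) * f la + wdown (wup f) la.
Proof.
rewrite -(kappa_q_kerov la) /wup /wdown.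
set n := #|` la |.
have la_in : la \in level n by rewrite mem_level.
have inner nu : covers la nu ->
    \sum_(tau \in [set tau | covers tau nu]) kappa tau nu * f tau
    = \sum_(tau <- level n | covers tau nu) kappa tau nu * f tau.
  by move=> /coversS sz; rewrite fsbig_covered // sz.
have inner' tau : covers tau la ->
    \sum_(nu \in [set nu | covers tau nu])
       kappa tau nu * q_skew q tau nu ^+ 2 * f nu
    = \sum_(nu <- level n | covers tau nu)
       kappa tau nu * q_skew q tau nu ^+ 2 * f nu.
  by move=> /coversS sz; rewrite fsbig_covering // -sz.
rewrite !(fsbig_covering levels_finite la).
rewrite !(fsbig_covered levels_finite la).
rewrite -/n.
under eq_bigr => nu cov do rewrite inner // mulr_sumr.
rewrite [X in _ = _ + X](eq_bigr (fun tau => \sum_(nu <- level n | covers tau nu)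
  kappa tau la * (kappa tau nu * q_skew q tau nu ^+ 2 * f nu))); last first.
  by move=> tau cov; rewrite inner' // mulr_sumr.
rewrite (exchange_big_dep predT) //= [X in _ = _ + X](exchange_big_dep predT) //=.
rewrite (bigD1_seq la) ?level_uniq //= [X in _ = _ + X](bigD1_seq la) ?level_uniq //=.
rewrite addrA; congr (_ + _).
  (* Diagonal part: the loops at [la] through a smaller ideal cancel the subtracted sum of
     [kerov_commutation]. *)
  rewrite mulrBl -[LHS]addr0 -addrA; congr (_ + _).
    rewrite mulr_suml; apply: eq_big => [nu|nu _]; first by rewrite andbb.
    by ring.
  apply/esym/eqP; rewrite addrC subr_eq0 mulr_suml; apply/eqP.
  by apply: eq_big => [nu|nu _]; [rewrite andbb|ring].
rewrite big_seq_cond [RHS]big_seq_cond; apply: eq_bigr => rho.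
rewrite mem_level // => /andP[/eqP sz neq].
rewrite (eq_bigr (fun nu =>
    f rho * (kappa la nu * kappa rho nu * q_skew q la nu ^+ 2)));
  last by move=> nu _; ring.
rewrite [RHS](eq_bigr (fun tau =>
    f rho * (kappa tau la * kappa tau rho * q_skew q tau rho ^+ 2)));
  last by move=> tau _; ring.
by rewrite -!mulr_sumr (sum_diamond _ sz) // eq_sym.
Qed.

Lemma wup_rdim mu la :
  wup (rdim kappa mu) la
  = (#|` la |.+1%:R - #|` mu |%:R) * (#|` la |%:R + #|` mu |%:R + tpar kappa q)
      * rdim kappa mu la
    + \sum_(rho \in [set rho | covers rho mu])
        kappa rho mu * q_skew q rho mu ^+ 2 * rdim kappa rho la.
Proof.
rewrite fsbig_covered //.
move Dn: #|` la | => n; elim: n la Dn => [|n IH] la sz.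
  (* With [la] empty, either [mu] is larger, or it is empty too and both sides are t dim(mu, la). *)
  case: (ltnP #|` la | #|` mu |) => [lt_la|]; first by rewrite wup_rdim_small // sz.
  rewrite sz leqn0 => /eqP sz_mu.
  rewrite (wup_ext (rdim_wdown_covering _)) ?sz ?sz_mu // wup_wdown sz.
  rewrite /wdown fsbig_covered // !big1; first by ring.
  - by move=> rho /coversS; rewrite sz_mu.
  - by move=> tau /coversS; rewrite sz.
case: (ltnP #|` la | #|` mu |) => [lt_la|le_mu].
  by rewrite wup_rdim_small // sz.
rewrite (wup_ext (rdim_wdown_covering le_mu)) wup_wdown sz.
have -> : wdown (wup (rdim kappa mu)) la
  = (n.+1%:R - #|` mu |%:R) * (n%:R + #|` mu |%:R + tpar kappa q)
      * wdown (rdim kappa mu) la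
    + \sum_(rho <- level #|` mu |.-1 | covers rho mu)
        kappa rho mu * q_skew q rho mu ^+ 2 * wdown (rdim kappa rho) la.
  rewrite /wdown !(fsbig_covered levels_finite la) sz /=.
  rewrite mulr_sumr; under [X in _ + X]eq_bigr do
    rewrite fsbig_covered // sz /= mulr_sumr.
  rewrite [X in _ + X]exchange_big -big_split /=.
  rewrite big_seq_cond [RHS]big_seq_cond; apply: eq_bigr => tau.
  rewrite mem_level // => /andP[/eqP sz_tau _].
  rewrite IH // [kappa _ _ * _]mulrDr; congr (_ + _); first by ring.
  by rewrite mulr_sumr; apply: eq_bigr => rho _; ring.
(* A [rho] covered by [mu] is strictly smaller than [la], so the recursion holds for dim(rho, la)
   even when |mu| = |la|. *)
rewrite [in RHS](eq_bigr (fun rho => kappa rho mu * q_skew q rho mu ^+ 2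
    * wdown (rdim kappa rho) la)); last first.
  by move=> rho /coversS sz_mu; rewrite -rdim_wdown // -sz_mu.
rewrite addrA; congr (_ + _).
case: (ltnP #|` mu | #|` la |) => [lt_mu|ge_mu].
  by rewrite -rdim_wdown // !mulrS; ring.
have -> : #|` mu | = n.+1 by apply/eqP; rewrite eqn_leq -sz le_mu ge_mu.
by rewrite !mulrS; ring.
Qed.

End WeightedKerov.

(** * Ratios of falling factorials to factorials *)

Lemma ffact_ratioS (R : numFieldType) (n k : nat) :
  (n ^_ k)%:R / n`!%:R = (n.+1 ^_ k.+1)%:R / (n.+1)`!%:R :> R.
Proof.
by rewrite ffactSS factS !natrM -mulf_div divff ?mul1r // pnatr_eq0.
Qed.

(** The ratio on the left is 1/(n - k)! for k <= n and 0 beyond. On the right, n + 1 - k vanishes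
    for k = n + 1 and the falling factorial for larger k. *)
Lemma ffact_ratio_sub (R : numFieldType) (n k : nat) :
  (n ^_ k)%:R / n`!%:R
  = (n.+1%:R - k%:R) * ((n.+1 ^_ k)%:R / (n.+1)`!%:R) :> R.
Proof.
rewrite ffact_ratioS ffactnSr natrM.
case: (leqP k n.+1) => [le_k|lt_k]; last by rewrite ffact_small // !(mul0r, mulr0).
by rewrite natrB //; ring.
Qed.

(** * The Kerov operators on the functions I_xi P*_mu *)

Section KerovOperators.
Context {d : Order.disp_t} {P : porderType d} {R : realType}.
Context (kappa : ideal P -> ideal P -> R) (q : P -> R) (xi : R).
Implicit Types (mu la nu rho : ideal P).
Hypothesis levels_finite :
  forall n : nat, finite_set [set la : ideal P | #|` la | = n].
Hypothesis kappa_gt0 : forall mu la, covers mu la -> 0 < kappa mu la.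
Hypothesis q_gt0 : forall x : P, 0 < q x.
Hypothesis xi_gt0 : 0 < xi.

Definition qprod la : R := \prod_(b <- enum_fset la) q b.

Lemma qprodS la nu : covers la nu -> qprod nu = q_skew q la nu * qprod la.
Proof.
move=> cov; have [x Dx Sx] := skew_eltP cov.
have x_nu : x \in (nu : {fset P}).
  have : x \in (nu `\` la)%fset by rewrite Dx fset11.
  by rewrite inE => /andP[].
rewrite /qprod (big_fsetD1 x) //= /q_skew Sx /=; congr (_ * _).
have -> : (nu `\ x)%fset = la :> {fset P} by rewrite -Dx fsetDK //; case/andP: cov.
by [].
Qed.

(** The square root of [Mxi] stripped of its factor dim la / |la|!. *)
Definition ideal_weight la : R :=
  Num.sqrt ((1 - xi) `^ tpar kappa q) * Num.sqrt xi ^+ #|` la | * qprod la.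

Lemma ideal_weightS la nu : covers la nu ->
  ideal_weight nu = Num.sqrt xi * q_skew q la nu * ideal_weight la.
Proof.
by move=> cov; rewrite /ideal_weight (qprodS cov) (coversS cov) exprS; ring.
Qed.

(** All factors of [Mxi] are nonnegative, so its square root splits, and dim la cancels against the
    denominator of [rel_dim]. *)
Lemma Ixi_rel_dim mu la :
  Ixi kappa q xi (rel_dim kappa mu) la
  = (#|` la | ^_ #|` mu |)%:R / (#|` la |)`!%:R
      * ideal_weight la * rdim kappa mu la.
Proof.
have dim_gt0 := gdim_gt0 levels_finite kappa_gt0 la.
have fact_gt0 : 0 < (#|` la |)`!%:R :> R by rewrite ltr0n fact_gt0.
rewrite /Ixi /rel_dim /Mxi prodrXl -/(qprod la).
have qprod_ge0 : 0 <= qprod la by apply: prodr_ge0 => b _; exact: ltW.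
rewrite -[_ * qprod la ^+ 2]mulrA -exprMn.
rewrite sqrtrM ?mulr_ge0 ?powR_ge0 ?exprn_ge0 ?(ltW xi_gt0) //.
rewrite sqrtr_sqr ger0_norm; last by rewrite mulr_ge0 // ltW // divr_gt0.
rewrite sqrtrM ?powR_ge0 //.
have -> : Num.sqrt (xi ^+ #|` la |) = Num.sqrt xi ^+ #|` la |.
  elim: #|` la | => [|n IH]; first by rewrite !expr0 sqrtr1.
  by rewrite !exprS sqrtrM ?ltW // IH.
rewrite /ideal_weight; field.
by rewrite !gt_eqF.
Qed.

Lemma kerovU_Ixi_rel_dim mu la :
  kerovU kappa q (Ixi kappa q xi (rel_dim kappa mu)) la
  = (Num.sqrt xi)^-1 * (#|` la |%:R - #|` mu |%:R)
      * Ixi kappa q xi (rel_dim kappa mu) la.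
Proof.
have sqrt_neq0 : Num.sqrt xi != 0 by rewrite gt_eqF ?sqrtr_gt0.
rewrite Ixi_rel_dim /kerovU fsbig_covered //.
(* At the empty ideal the sum is empty, so the right side must vanish: through |la| - |mu| if [mu]
   is empty, through dim(mu, la) otherwise. *)
case: (posnP #|` la |) => [sz|la_gt0].
  rewrite big1; last by move=> tau /coversS; rewrite sz.
  case: (posnP #|` mu |) => [->|mu_gt0]; first by rewrite sz subrr mulr0 mul0r.
  rewrite rdim_small ?sz // (negPf (_ : mu != la)) ?mulr0 //.
  by apply: contraTneq mu_gt0 => ->; rewrite sz.
have -> : (Num.sqrt xi)^-1 * (#|` la |%:R - #|` mu |%:R)
    * ((#|` la | ^_ #|` mu |)%:R / (#|` la |)`!%:R * ideal_weight la * rdim kappa mu la)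
  = (Num.sqrt xi)^-1 * ((#|` la |.-1 ^_ #|` mu |)%:R / (#|` la |.-1)`!%:R)
      * ideal_weight la * wdown kappa (rdim kappa mu) la.
  rewrite (ffact_ratio_sub R #|` la |.-1) prednK //.
  case: (ltnP #|` mu | #|` la |) => [lt_mu|].
    by rewrite -rdim_wdown //; ring.
  rewrite leq_eqVlt => /orP[/eqP ->|lt_la]; first by rewrite subrr; ring.
  by rewrite ffact_small // !(mul0r, mulr0).
rewrite /wdown fsbig_covered // mulr_sumr; apply: eq_bigr => tau cov.
rewrite Ixi_rel_dim (ideal_weightS cov) (coversS cov) /=.
by field; rewrite sqrt_neq0 pnatr_eq0 -lt0n fact_gt0.
Qed.

Hypothesis kappa_self_dual : UD_self_dual kappa.
Hypothesis kappa_q_kerov : kerov_commutation kappa q.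

Lemma kerovD_Ixi_rel_dim mu la :
  kerovD kappa q (Ixi kappa q xi (rel_dim kappa mu)) la
  = Num.sqrt xi * (#|` la |%:R + #|` mu |%:R + tpar kappa q)
      * Ixi kappa q xi (rel_dim kappa mu) la
    + Num.sqrt xi * \sum_(rho \in [set rho | covers rho mu])
        kappa rho mu * q_skew q rho mu ^+ 2
          * Ixi kappa q xi (rel_dim kappa rho) la.
Proof.
have -> : kerovD kappa q (Ixi kappa q xi (rel_dim kappa mu)) la
  = Num.sqrt xi * ((#|` la |.+1 ^_ #|` mu |)%:R / (#|` la |.+1)`!%:R)
      * ideal_weight la * wup kappa q (rdim kappa mu) la.
  rewrite /kerovD /wup !fsbig_covering // mulr_sumr; apply: eq_bigr => nu cov.
  by rewrite Ixi_rel_dim (ideal_weightS cov) (coversS cov); ring.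
rewrite wup_rdim // Ixi_rel_dim (ffact_ratio_sub R #|` la |) mulrDr.
congr (_ + _); first by ring.
(* Since |mu| = |rho| + 1, the factorial ratio at (|la| + 1, |mu|) is the one at (|la|, |rho|). *)
rewrite !fsbig_covered // !mulr_sumr; apply: eq_bigr => rho /coversS sz.
by rewrite Ixi_rel_dim sz (ffact_ratioS R #|` la |); ring.
Qed.

End KerovOperators.

Theorem theorem5p2 (d : Order.disp_t) (P : porderType d) (R : realType)
    (kappa : ideal P -> ideal P -> R) (q : P -> R) (xi : R)
    (in_finite_ideal : forall x : P, exists la : ideal P, x \in (la : {fset P}))
    (levels_finite :
      forall n : nat, finite_set [set la : ideal P | #|` la | = n])
    (growing : forall la : ideal P, exists nu : ideal P, covers la nu)
    (kappa_gt0 : forall mu la : ideal P, covers mu la -> 0 < kappa mu la)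
    (kappa_self_dual : UD_self_dual kappa)
    (q_gt0 : forall x : P, 0 < q x)
    (kappa_q_kerov : kerov_commutation kappa q)
    (tpar_gt0 : 0 < tpar kappa q)
    (xi_gt0 : 0 < xi) (xi_lt1 : xi < 1)
    (mu : ideal P) :
  (forall la : ideal P,
     kerovU kappa q (Ixi kappa q xi (rel_dim kappa mu)) la
     = (Num.sqrt xi)^-1 * (#|` la |%:R - #|` mu |%:R)
         * Ixi kappa q xi (rel_dim kappa mu) la)
  /\
  (forall la : ideal P,
     kerovD kappa q (Ixi kappa q xi (rel_dim kappa mu)) la
     = Num.sqrt xi * (#|` la |%:R + #|` mu |%:R + tpar kappa q)
         * Ixi kappa q xi (rel_dim kappa mu) la
       + Num.sqrt xi * \sum_(rho \in [set rho : ideal P | covers rho mu])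
           kappa rho mu * q_skew q rho mu ^+ 2
             * Ixi kappa q xi (rel_dim kappa rho) la).
Proof.
split=> la; first exact: kerovU_Ixi_rel_dim.
exact: kerovD_Ixi_rel_dim.
Qed.
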